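(* Assume that for every $a\in A$ the set $\mathcal P_a$ is closed. 1. If there is no information the sender would share (i.e. $\hat\nu(\mu)\le\mathbf E_\mu[v(\bar\omega,a_{\mu^*})]$ for all $\mu\in\Delta(\Omega)$), then the sender does not benefit from persuasion. If there is information the sender would share (i.e. there is $\mu\in\Delta(\Omega)$ with $\hat\nu(\mu)>\mathbf E_\mu[v(\bar\omega,a_{\mu^*})]$) and $\mu^*$ lies in the interior of $\mathcal P_{a_{\mu^*}}$, then the sender benefits from persuasion. 2. If for each $a\in A$ and each $m_a\in\mathrm{Conv}(\mathcal P_a)$ we have $\sum_{\omega\in\Omega}m_a(\omega)\big(v(\omega,a)-v(\omega,a_{\mu^*})\big)\le 0$, then the sender does not benefit from persuasion. If $\mu^*$ is in the interior of $\mathcal P_{a_{\mu^*}}$ and there exist $a\in A$ and $m_a\in\mathrm{Conv}(\mathcal P_a)$ with $\sum_{\omega\in\Omega}m_a(\omega)\big(v(\omega,a)-v(\omega,a_{\mu^*})\big)>0$, then the sender benefits from persuasion.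
   Context: $\Omega$ (states) and $A$ (actions) are finite nonempty sets, $\Delta(\Omega)\subset\mathbb R^\Omega$ is the simplex of probability vectors, $\mu^*\in\Delta(\Omega)$ the prior. The receiver's utility is an arbitrary function $\rho:\Delta(\Omega)\times A\to\mathbb R$, the sender's utility is $v:\Omega\times A\to\mathbb R$, and $\mathcal P_a=\{\mu\in\Delta(\Omega):a\in\arg\max_{a'\in A}\rho(\mu,a')\}$. $\mathrm{Conv}$ denotes convex hull and $\mathbf 0\in\mathbb R^\Omega$ the zero vector. $\mathbf E_\mu[v(\bar\omega,a)]=\sum_\omega\mu(\omega)v(\omega,a)$. For each $\mu\in\Delta(\Omega)$, $a_\mu\in\{a\in A:\mu\in\mathcal P_a\}$ denotes the receiver's optimal action at belief $\mu$, with ties broken in favour of the sender (i.e. $a_\mu$ maximizes $\mathbf E_\mu[v(\bar\omega,a)]$ over $\{a:\mu\in\mathcal P_a\}$). $\hat\nu(\mu)=\mathbf E_\mu[v(\bar\omega,a_\mu)]$ is the sender's payoff without persuasion. $V(\mu^* )$ is the sender's optimal payoff from persuasion, equal to the maximum of $\sum_{\omega}\sum_{a}t_a(\omega)v(\omega,a)$ over $\{t_a\}_{a\in A}$ with $t_a\in\mathrm{Conv}(\mathcal P_a\cup\{\mathbf 0\})$ for all $a$ and $\sum_a t_a=\mu^*$. The sender benefits from persuasion if $V(\mu^* )>\hat\nu(\mu^* )$. ''Interior'' of a subset of $\Delta(\Omega)$ means interior relative to the affine hyperplane $\{x\in\mathbb R^\Omega:\sum_\omega x(\omega)=1\}$.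 *)

(* Defs.v *)
From mathcomp Require Import all_boot all_order all_algebra.
From mathcomp Require Import all_classical all_reals all_analysis.

Set Implicit Arguments.
Unset Strict Implicit.
Unset Printing Implicit Defensive.

Import Order.TTheory GRing.Theory Num.Theory.
Import numFieldNormedType.Exports.
Local Open Scope classical_set_scope.
Local Open Scope ring_scope.

(* Vectors of R^Omega are plain functions [Omega -> R], which carry a vector
   space structure but no canonical topology; whenever topology is involved they
   are seen in [{ptws Omega -> R}], i.e. with the product topology, which is the
   Euclidean one as Omega is finite. *)

Section Defs.
Context {R : realType} {Omega A : finType}.
Implicit Types (mu x : Omega -> R) (v : Omega -> A -> R).

Definition simplex : set (Omega -> R) :=
  [set mu | (forall w, 0 <= mu w) /\ \sum_w mu w = 1].

Definition hyperplane : set {ptws Omega -> R} := [set x | \sum_w x w = 1].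

Definition hyperplane_interior (B : set (Omega -> R)) : set (Omega -> R) :=
  @interior (subspace hyperplane) B.

Definition Conv (X : set (Omega -> R)) : set (Omega -> R) :=
  smallest (@convex_set R (Omega -> R)) X.

Definition expect mu (f : Omega -> R) : R := \sum_w mu w * f w.

(* The receiver's utility [rho] is a total function, but only its values on the
   simplex are ever used. *)
Definition optimal_beliefs (rho : (Omega -> R) -> A -> R) (a : A) :
    set (Omega -> R) :=
  [set mu | simplex mu /\ forall a', rho mu a' <= rho mu a].

(* [act mu] is the action written a_mu in the mathematics: a receiver-optimal
   action, best for the sender among those. Several such selections may exist. *)
Definition sender_preferred (rho : (Omega -> R) -> A -> R) v
    (act : (Omega -> R) -> A) : Prop :=
  forall mu, simplex mu ->
    optimal_beliefs rho (act mu) mu /\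
    forall a, optimal_beliefs rho a mu ->
      expect mu (v^~ a) <= expect mu (v^~ (act mu)).

Definition nu_hat v (act : (Omega -> R) -> A) mu : R :=
  expect mu (v^~ (act mu)).

Definition feasible (rho : (Omega -> R) -> A -> R) mu
    : set (A -> Omega -> R) :=
  [set t | (forall a, Conv (optimal_beliefs rho a `|` [set 0]) (t a)) /\
           \sum_a t a = mu].

Definition payoffs (rho : (Omega -> R) -> A -> R) v mu : set R :=
  [set \sum_w \sum_a t a w * v w a | t in feasible rho mu].

(* The maximum of the payoffs. It exists as soon as mu is in the simplex and all
   the [optimal_beliefs rho a] are closed; otherwise [get] may return a default
   value. *)
Definition persuasion_value (rho : (Omega -> R) -> A -> R) v mu : R :=
  get (payoffs rho v mu `&` ubound (payoffs rho v mu)).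

Definition benefits (rho : (Omega -> R) -> A -> R) v
    (act : (Omega -> R) -> A) mu : Prop :=
  nu_hat v act mu < persuasion_value rho v mu.

End Defs.

(* Main.v *)
(* Write b for the action taken at mustar. If no belief gains, the halfspace where
   the expectation of v(., a) - v(., b) is at most 0 contains P_a and 0, hence t_a,
   for each a, so no feasible t gains. Conversely, if sharing mu gains and mustar
   is interior to P_b, then mustar is a convex combination of mu and of a belief in
   P_b slightly beyond mustar on the line from mu, and revealing these two
   posteriors gains.
   The value of persuasion is a junk value unless the maximum is attained: by a
   Caratheodory argument, every payoff is dominated by one that uses #|Omega|
   posteriors, and such payoffs form a compact set. *)
Require Import Defs.
From mathcomp Require Import all_boot all_order all_algebra.
From mathcomp Require Import all_classical all_reals all_analysis.
From mathcomp Require Import ring lra.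

Import Order.TTheory GRing.Theory Num.Theory.
Import numFieldNormedType.Exports.
Set Implicit Arguments.
Unset Strict Implicit.
Unset Printing Implicit Defensive.

Local Open Scope classical_set_scope.
Local Open Scope ring_scope.

(** * Caratheodory reduction of weighted points *)

(* A dependence c among the points may be oriented so that it does not lower the
   value; as its weights sum to 0 some are negative, so following it long enough
   cancels a weight. *)
Lemma caratheodory_step (R : realFieldType) (T : finType) (n : nat)
    (l u : 'I_n.+1 -> R) (p : 'I_n.+1 -> T -> R) :
  (#|T| <= n)%N -> (forall i, 0 <= l i) -> (forall i, \sum_w p i w = 1) ->
  exists (l' : 'I_n.+1 -> R) (i0 : 'I_n.+1),
    [/\ forall i, 0 <= l' i, l' i0 = 0,
        forall w, \sum_i l' i * p i w = \sum_i l i * p i w &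
        \sum_i l i * u i <= \sum_i l' i * u i].
Proof.
move=> Tn l0 p1.
have [c0 c0N0 c0p] : exists2 c : 'I_n.+1 -> R,
    (exists i, c i != 0) & forall w, \sum_i c i * p i w = 0.
  pose M := \matrix_(i < n.+1, j < #|T|) p i (enum_val j).
  (* The [n.+1] rows have length at most [n], so they are linearly dependent; a vector of the left
     kernel is the dependence. *)
  have : kermx M != 0.
    by rewrite kermx_eq0 /row_free neq_ltn (leq_ltn_trans (rank_leq_col M)).
  case/rowV0Pn => c /sub_kermxP cM /rV0Pn[i ci]; exists (c 0).
    by exists i.
  move=> w; move/matrixP/(_ 0 (enum_rank w)): cM; rewrite !mxE => cMw.
  rewrite -[RHS]cMw.
  by apply: eq_bigr => j _; rewrite mxE enum_rankK.
have {c0 c0N0 c0p} [c [cN0 cp cu]] : exists c : 'I_n.+1 -> R,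
    [/\ exists i, c i != 0, forall w, \sum_i c i * p i w = 0 &
        0 <= \sum_i c i * u i].
  have [u0|/ltW u0] := leP 0 (\sum_i c0 i * u i); first by exists c0.
  exists (fun i => - c0 i); split.
  - by case: c0N0 => i ci; exists i; rewrite oppr_eq0.
  - move=> w; under eq_bigr do rewrite mulNr.
    by rewrite sumrN c0p oppr0.
  - by under eq_bigr do rewrite mulNr; rewrite sumrN oppr_ge0.
have c_sum0 : \sum_i c i = 0.
  transitivity (\sum_i \sum_w c i * p i w).
    by apply: eq_bigr => i _; rewrite -mulr_sumr p1 mulr1.
  by rewrite exchange_big big1.
have [i1 ci1] : exists i, c i < 0.
  apply/existsP; case: cN0 => i; apply: contra_neqT => /existsPn cge0.
  by apply: (psumr_eq0P _ c_sum0) => // j _; rewrite leNgt; exact: cge0.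
(* Ratio test: the least ratio is the longest step along [c] that keeps every weight nonnegative. *)
have [i0 ci0 i0min] :=
  @arg_minP _ _ _ i1 (fun i => c i < 0) (fun i => l i / - c i) ci1.
set t := l i0 / - c i0 in i0min.
have t0 : 0 <= t by rewrite divr_ge0 // oppr_ge0 ltW.
exists (fun i => l i + t * c i), i0; split.
- move=> i; have [ci|ci] := leP 0 (c i);
    first by apply: addr_ge0 => //; exact: mulr_ge0.
  have := i0min i ci; rewrite ler_pdivlMr ?oppr_gt0 //; lra.
- by rewrite /t invrN mulrN mulNr divfK ?subrr // lt_eqF.
- move=> w; under eq_bigr do rewrite mulrDl -mulrA.
  by rewrite big_split /= -mulr_sumr cp mulr0 addr0.
- under [leRHS]eq_bigr do rewrite mulrDl -mulrA.
  by rewrite big_split /= -mulr_sumr lerDl mulr_ge0.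
Qed.

(** * Decompositions of a vector into labelled beliefs *)

Definition ord_cat {T : Type} {m n : nat} (f : 'I_m -> T) (g : 'I_n -> T)
  (i : 'I_(m + n)) : T :=
  match fintype.split i with inl j => f j | inr k => g k end.

Lemma ord_catl T m n (f : 'I_m -> T) (g : 'I_n -> T) j :
  ord_cat f g (lshift n j) = f j.
Proof. by rewrite /ord_cat (unsplitK (inl j)). Qed.

Lemma ord_catr T m n (f : 'I_m -> T) (g : 'I_n -> T) k :
  ord_cat f g (rshift m k) = g k.
Proof. by rewrite /ord_cat (unsplitK (inr k)). Qed.

Lemma ord_catP T (Q : T -> Prop) m n (f : 'I_m -> T) (g : 'I_n -> T) :
  (forall j, Q (f j)) -> (forall k, Q (g k)) -> forall i, Q (ord_cat f g i).
Proof. by move=> Qf Qg i; rewrite /ord_cat; case: fintype.split. Qed.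

Section Decomposition.
Context {R : realFieldType} {Omega A : finType}.
Variables (P : A -> set (Omega -> R)) (u : A -> (Omega -> R) -> R).

(* x is a nonnegative combination, with value y, of n beliefs labelled by
   actions; the weights need not sum to 1. *)
Definition decomposes (n : nat) (x : Omega -> R) (y : R) : Prop :=
  exists (l : 'I_n -> R) (q : 'I_n -> A * (Omega -> R)),
    [/\ forall i, 0 <= l i, forall i, P (q i).1 (q i).2,
        forall w, x w = \sum_i l i * (q i).2 w &
        y = \sum_i l i * u (q i).1 (q i).2].

Lemma decomposes0 : decomposes 0 0 0.
Proof.
have e (i : 'I_0) : False by case: i.
exists (fun=> 0), (fun i => match e i with end).
by split=> [i|i|w|] //; rewrite ?big_ord0 //; case: (e i).
Qed.

Lemma decomposes1 k a mu :
  0 <= k -> P a mu -> decomposes 1 (k *: mu) (k * u a mu).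
Proof.
move=> k0 Pmu; exists (fun=> k), (fun=> (a, mu)).
by split=> // [w|]; rewrite big_ord1.
Qed.

Lemma decomposesD m n x x' y y' :
  decomposes m x y -> decomposes n x' y' ->
  decomposes (m + n) (x + x') (y + y').
Proof.
move=> [l [q [l0 Pq xE ->]]] [l' [q' [l'0 Pq' x'E ->]]].
exists (ord_cat l l'), (ord_cat q q'); split.
- exact: (@ord_catP _ (fun r => 0 <= r)).
- exact: (@ord_catP _ (fun z => P z.1 z.2)).
- move=> w; rewrite big_split_ord; congr (_ + _); rewrite ?xE ?x'E;
    by apply: eq_bigr => i _; rewrite ?ord_catl ?ord_catr.
- rewrite big_split_ord; congr (_ + _);
    by apply: eq_bigr => i _; rewrite ?ord_catl ?ord_catr.
Qed.

Lemma decomposesZ n k x y :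
  0 <= k -> decomposes n x y -> decomposes n (k *: x) (k * y).
Proof.
move=> k0 [l [q [l0 Pq xE ->]]]; exists (fun i => k * l i), q; split=> //.
- by move=> i; rewrite mulr_ge0.
- move=> w; rewrite [LHS](_ : _ = k * x w) // xE mulr_sumr.
  by apply: eq_bigr => i _; rewrite mulrA.
- by rewrite mulr_sumr; apply: eq_bigr => i _; rewrite mulrA.
Qed.

Hypothesis P_sum1 : forall a mu, P a mu -> \sum_w mu w = 1.

(** One Caratheodory step makes some weight vanish, and that belief is dropped; labels and beliefs
    are kept, so only the weights change. *)
Lemma decomposes_shorten n x y : (#|Omega| <= n)%N -> decomposes n.+1 x y ->
  exists2 y', y <= y' & decomposes n x y'.
Proof.
move=> le_n [l [q [l0 Pq xE ->]]].
have [l' [i0 [l'0 l'i0 l'q l'u]]] :=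
  @caratheodory_step _ _ _ l (fun i => u (q i).1 (q i).2) (fun i => (q i).2)
    le_n l0 (fun i => P_sum1 (Pq i)).
exists (\sum_i l' i * u (q i).1 (q i).2) => //.
exists (l' \o lift i0), (q \o lift i0); split=> //= [w|].
- by rewrite xE -l'q (bigD1_ord i0) //= l'i0 mul0r add0r.
- by rewrite (bigD1_ord i0) //= l'i0 mul0r add0r.
Qed.

(** Long decompositions lose one belief at a time. Short ones are padded with copies of [mu] of
    weight 0, for which some belief must be available. *)
Lemma decomposes_card n x y a mu : P a mu -> decomposes n x y ->
  exists2 y', y <= y' & decomposes #|Omega| x y'.
Proof.
move=> Pmu; have [le_n|/ltnW le_n] := leqP n #|Omega|.
  move=> xy; exists y => //; rewrite -(subnKC le_n).
  elim: (_ - _)%N => [|k IHk]; first by rewrite addn0.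
  have := decomposesD IHk (decomposes1 (lexx 0) Pmu).
  by rewrite scale0r mul0r !addr0 addn1 addnS.
rewrite -(subnKC le_n); elim: (_ - _)%N y => [|k IHk] y.
  by rewrite addn0; exists y.
rewrite addnS => /decomposes_shorten[|y' yy' /IHk[y'' y'y'' ?]].
  by rewrite leq_addr.
by exists y'' => //; exact: le_trans y'y''.
Qed.

End Decomposition.

(** * Continuity in the product topology *)

Lemma continuous_sum (R : realType) (T : topologicalType) (I : finType)
    (f : I -> T -> R) :
  (forall i, continuous (f i)) -> continuous (fun t => \sum_i f i t).
Proof.
move=> cf; elim: (index_enum I) => [|i s IHs].
  by under eq_fun do rewrite big_nil; move=> t; exact: cvg_cst.
under eq_fun do rewrite big_cons.
by move=> t; apply: cvgD; [exact: cf|exact: IHs].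
Qed.

Lemma continuous_sumM (R : realType) (T : topologicalType) (I : finType)
    (f g : I -> T -> R) :
  (forall i, continuous (f i)) -> (forall i, continuous (g i)) ->
  continuous (fun t => \sum_i f i t * g i t).
Proof.
move=> cf cg; apply: continuous_sum => i t.
by apply: cvgM; [exact: cf|exact: cg].
Qed.

Lemma ptws_continuous (T : topologicalType) (I : Type) (V : uniformType)
    (f : T -> {ptws I -> V}) :
  (forall i, continuous (fun t => f t i)) -> continuous f.
Proof.
move=> cf t; apply/cvg_sup => i.
by apply: (@continuous_comp_initial _ T V (fun g : I -> V => g i) f) => s;
  exact: cf.
Qed.

Lemma ptws_eval_continuous (R : realType) (I : finType) (i : I) :
  continuous (fun f : {ptws I -> R} => f i).
Proof. exact: (@proj_continuous I (fun=> R) i). Qed.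

(** * Compactness of decompositions of fixed length *)

Section Attained.
Context {R : realType} {Omega A : finType}.
Variables (P : A -> set (Omega -> R)) (u : A -> {ptws Omega -> R} -> R).
Hypothesis P_simplex : forall a, P a `<=` simplex.
Hypothesis P_closed : forall a, closed (P a : set {ptws Omega -> R}).
Hypothesis u_cont : forall a, continuous (u a).

(** For each of the finitely many labellings by actions, the admissible weights and beliefs form a
    closed subset of a cube, on which the value is continuous. The values thus form a finite union
    of compact sets. *)
Lemma decomposes_max n x y0 : simplex x -> decomposes P u n x y0 ->
  exists2 y, decomposes P u n x y & forall y', decomposes P u n x y' -> y' <= y.
Proof.
move=> [x0 x1] dec0.
(* One function stores a whole decomposition: the coordinate [(i, None)] is the weight of the i-th
   belief, and the [(i, Some w)] are its entries. *)
pose T : topologicalType := {ptws 'I_n * option Omega -> R}.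
pose mass (i : 'I_n) (f : T) : R := f (i, None).
pose belief (i : 'I_n) (f : T) : {ptws Omega -> R} := fun w => f (i, Some w).
have eval_cont z : continuous ((fun f => f z) : T -> R).
  exact: ptws_eval_continuous.
have belief_cont i : continuous (belief i).
  by apply: ptws_continuous => w; exact: eval_cont.
pose box : set T := [set f | forall z, `[0, 1]%classic (f z)].
pose K (a : {ffun 'I_n -> A}) : set T := [set f | box f /\
  (forall i, P (a i) (belief i f)) /\
  forall w, \sum_i mass i f * belief i f w = x w].
pose obj (a : {ffun 'I_n -> A}) (f : T) :=
  \sum_i mass i f * u (a i) (belief i f).
have obj_cont a : continuous (obj a).
  apply: (@continuous_sumM R T _ mass (fun i => u (a i) \o belief i)) => i.
    exact: eval_cont.
  exact: (fun f =>
    continuous_comp (@belief_cont i f) (@u_cont (a i) (belief i f))).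
have K_compact a : compact (K a).
  apply: (@subclosed_compact _ _ box); last by move=> f [].
    rewrite (_ : K a = \bigcap_z ((fun f => f z) @^-1` `[0, 1]%classic) `&`
        (\bigcap_i (belief i @^-1` P (a i)) `&`
         \bigcap_w ((fun f => \sum_i mass i f * belief i f w) @^-1`
                      [set r | r = x w]))); last first.
      apply/seteqP; split=> f [bf [Pf xf]]; split.
      - by move=> z _; exact: bf.
      - by split=> z _; [exact: Pf|exact: xf].
      - by move=> z; exact: (bf z I).
      - by split=> z; [exact: (Pf z I)|exact: (xf z I)].
    apply: closedI; [|apply: closedI]; apply: closed_bigI => z _.
    - apply: (@preimage_closed T R (fun f => f z)).
        by move=> f _; exact: eval_cont.
      exact: interval_closed.
    - by apply: preimage_closed => // f _; exact: belief_cont.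
    - apply: (@preimage_closed T R
        (fun f => \sum_i mass i f * belief i f z)); last exact: closed_eq.
      move=> f _; move: f.
      by apply: (@continuous_sumM R T _ mass (fun i f => belief i f z)) => i;
        exact: eval_cont.
  apply: (@tychonoff _ (fun=> R) (fun=> `[0, 1]%classic)) => z.
  exact: segment_compact.
pose S : set R := \big[setU/set0]_(a : {ffun 'I_n -> A}) (obj a @` K a).
have SP y : S y <-> decomposes P u n x y.
  rewrite /S -bigcup_seq; split.
    move=> [a _ [f [bf [Pf fx]] <-]].
    exists (fun i => mass i f), (fun i => (a i, belief i f)); split=> //.
      by move=> i; have /= := bf (i, None); rewrite in_itv /= => /andP[].
    by move=> w; rewrite fx.
  move=> [l [q [l0 Pq xE ->]]]; exists [ffun i => (q i).1] => /=.
    by rewrite mem_index_enum.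
  exists (fun z => if z.2 is Some w then (q z.1).2 w else l z.1); last first.
    by apply: eq_bigr => i _; rewrite ffunE.
  split; last by split=> [i|w]; rewrite ?ffunE; [exact: Pq|].
  have P1 i : \sum_w (q i).2 w = 1 by have [] := P_simplex (Pq i).
  have Pge0 i w : 0 <= (q i).2 w by have [] := P_simplex (Pq i).
  (* Since [x] and all the beliefs have mass 1, so do the weights together; hence each weight is at
     most 1 and the decomposition fits in the box. *)
  have l1 : \sum_i l i = 1.
    rewrite -x1 [RHS](eq_bigr _ (fun w _ => xE w)) exchange_big.
    by apply: eq_bigr => i _; rewrite -mulr_sumr P1 mulr1.
  move=> [i [w|]] /=; rewrite in_itv /= ?Pge0 ?l0 /=.
    by rewrite -(P1 i) (bigD1 w) //= lerDl sumr_ge0.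
  by rewrite -l1 (bigD1 i) //= lerDl sumr_ge0.
have S_compact : compact S.
  apply: bigsetU_compact => a _; apply: continuous_compact => //.
  exact: continuous_subspaceT.
have [||y yS ymax] := @compact_EVT_max R R id S _ S_compact.
- by exists y0; apply/SP.
- by apply: continuous_subspaceT => z; exact: cvg_id.
exists y; first by apply/SP; rewrite inE in yS.
by move=> y' /SP Sy'; apply: ymax; rewrite inE.
Qed.

End Attained.

(** * Linearity of expectations, and convex hulls *)

Section Persuasion.
Context {R : realType} {Omega A : finType}.
Implicit Types (mu x m : Omega -> R) (f : Omega -> R) (X C : set (Omega -> R)).

Lemma expect0 f : expect 0 f = 0.
Proof. by rewrite /expect big1 // => w _; rewrite mul0r. Qed.

Lemma expectD x y f : expect (x + y) f = expect x f + expect y f.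
Proof. by rewrite -big_split; apply: eq_bigr => w _; rewrite mulrDl. Qed.

Lemma expectZ (k : R) x f : expect (k *: x) f = k * expect x f.
Proof. by rewrite mulr_sumr; apply: eq_bigr => w _; rewrite mulrA. Qed.

Lemma expectB x f g :
  \sum_w x w * (f w - g w) = expect x f - expect x g.
Proof. by rewrite -sumrB; apply: eq_bigr => w _; rewrite mulrBr. Qed.

Lemma expect_sum (I : finType) (Q : pred I) (l : I -> R) (p : I -> Omega -> R)
    f :
  expect (\sum_(i | Q i) l i *: p i) f = \sum_(i | Q i) l i * expect (p i) f.
Proof.
elim/big_rec2 : _ => [|i r x _ <-]; first exact: expect0.
by rewrite expectD expectZ.
Qed.

Lemma expect_continuous f :
  continuous (fun x : {ptws Omega -> R} => expect x f).
Proof.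
pose T : topologicalType := {ptws Omega -> R}.
apply: (@continuous_sumM R T _ (fun w (x : T) => x w : R)
  (fun w _ => f w)) => w.
  exact: ptws_eval_continuous.
exact: cst_continuous.
Qed.

Lemma convex_setP C : convex_set C <->
  forall x y (k : R), 0 <= k -> k <= 1 -> C x -> C y ->
    C (k *: x + (1 - k) *: y).
Proof.
split=> [cC x y k k0 k1 Cx Cy|cC x y k].
  by have := cC x y (Itv01 k0 k1); rewrite !inE; exact.
by rewrite !inE => Cx Cy; exact: cC.
Qed.

Lemma sub_Conv X : X `<=` Conv X.
Proof. exact: sub_gen_smallest. Qed.

Lemma Conv_sub X C : convex_set C -> X `<=` C -> Conv X `<=` C.
Proof. exact: smallest_sub. Qed.

Lemma convex_Conv X : convex_set (Conv X).
Proof.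
apply/convex_setP => x y k k0 k1 Xx Xy C CX; have /convex_setP cC := CX.1.
by apply: cC => //; [exact: Xx|exact: Xy].
Qed.

Lemma convex_halfspace f : convex_set [set x | expect x f <= 0].
Proof.
apply/convex_setP => x y k k0 k1 /= xf yf.
rewrite expectD !expectZ -oppr_ge0 opprD -!mulrN.
by rewrite addr_ge0 // mulr_ge0 ?subr_ge0 ?oppr_ge0.
Qed.

(** The weight missing to reach 1 is put on the point 0 of [C]. *)
Lemma convex_subsum C (I : finType) (Q : pred I) (l : I -> R)
    (p : I -> Omega -> R) :
  convex_set C -> C 0 -> (forall i, C (p i)) -> (forall i, 0 <= l i) ->
  \sum_(i | Q i) l i <= 1 -> C (\sum_(i | Q i) l i *: p i).
Proof.
move=> /convex_setP cC C0 Cp l0 l1.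
(* Writing a partial sum as its total weight times a point of [C] lets the induction run without a
   bound on the weights. If the total is 0, the point 0 serves. *)
have [k0 [c [Cc ->]]] : 0 <= \sum_(i | Q i) l i /\ exists c, C c /\
    \sum_(i | Q i) l i *: p i = (\sum_(i | Q i) l i) *: c.
  elim/big_rec2 : _ => [|i x k _ [k0 [c [Cc ->]]]].
    by split=> //; exists 0; rewrite scale0r.
  split; first exact: addr_ge0.
  have [/eqP|s0] := eqVneq (l i + k) 0.
    rewrite paddr_eq0 // => /andP[/eqP-> /eqP->]; exists 0.
    by rewrite !scale0r !addr0 scale0r.
  exists ((l i / (l i + k)) *: p i + (1 - l i / (l i + k)) *: c); split.
    apply: cC => //; first by rewrite divr_ge0 ?addr_ge0.
    by rewrite ler_pdivrMr ?mul1r ?lerDl // lt_neqAle eq_sym s0 addr_ge0.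
  by rewrite scalerDr !scalerA; congr (_ *: _ + _ *: _); field.
rewrite -[_ *: c]addr0 -[X in _ + X](scaler0 _ (1 - \sum_(i | Q i) l i)).
exact: cC.
Qed.

(** * Payoffs as values of decompositions *)

Variables (rho : (Omega -> R) -> A -> R) (v : Omega -> A -> R).

Let P := optimal_beliefs rho.
Let u (a : A) mu := expect mu (v^~ a).

Lemma payoffE (t : A -> Omega -> R) :
  \sum_w \sum_a t a w * v w a = \sum_a u a (t a).
Proof. by rewrite exchange_big. Qed.

(** Grouping the weighted beliefs by label gives the family [t]. *)
Lemma decomposes_payoffs n mu y : simplex mu -> decomposes P u n mu y ->
  payoffs rho v mu y.
Proof.
move=> [_ mu1] [l [q [l0 Pq muE ->]]].
have q1 i : \sum_w (q i).2 w = 1 by have [[]] := Pq i.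
have l1 : \sum_i l i = 1.
  rewrite -mu1 [RHS](eq_bigr _ (fun w _ => muE w)) exchange_big.
  by apply: eq_bigr => i _; rewrite -mulr_sumr q1 mulr1.
exists (fun a => \sum_(i | (q i).1 == a) l i *: (q i).2).
  split=> [a|].
    (* Beliefs with another label are replaced by 0, which keeps the sum inside the hull of [P a]
       and 0. *)
    rewrite big_mkcond (eq_bigr (fun i =>
      l i *: (if (q i).1 == a then (q i).2 else 0))) => [|i _]; last first.
      by case: ifP; rewrite ?scaler0.
    apply: (@convex_subsum _ _ xpredT) => //; first exact: convex_Conv.
    - by apply: sub_Conv; right.
    - move=> i; apply: sub_Conv; case: eqP => [<-|_].
        by left; exact: Pq.
      by right.
    - by rewrite l1.
  rewrite (_ : mu = \sum_i l i *: (q i).2); last first.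
    by apply/funext => w; rewrite fct_sumE muE.
  by rewrite [RHS](partition_big (fun i => (q i).1) xpredT).
rewrite payoffE; under eq_bigr do rewrite /u expect_sum.
rewrite [RHS](partition_big (fun i => (q i).1) xpredT) //=.
by apply: eq_bigr => a _; apply: eq_bigr => i /eqP ->.
Qed.

(** As [u a] is linear, the vectors [x] that decompose with value [u a x] form a convex set; it
    contains [P a] and 0, hence [t a]. Concatenating over the actions gives [mu]. *)
Lemma feasible_decomposes mu t : feasible rho mu t ->
  exists n, decomposes P u n mu (\sum_a u a (t a)).
Proof.
move=> [tC <-]; elim/big_rec2 : _ => [|a y x _ [n dec]].
  by exists 0%N; exact: decomposes0.
suff [n' dec'] : [set x | exists k : nat, decomposes P u k x (u a x)] (t a).
  by exists (n' + n)%N; exact: decomposesD.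
apply: Conv_sub (tC a).
  apply/convex_setP => x1 x2 k k0 k1 [m1 dec1] [m2 dec2]; exists (m1 + m2)%N.
  rewrite /u expectD !expectZ; apply: decomposesD; apply: decomposesZ => //.
  by rewrite subr_ge0.
move=> x' [Px'|->]; last first.
  by exists 0%N; rewrite /u expect0; exact: decomposes0.
exists 1%N; have := decomposes1 u ler01 Px'; by rewrite scale1r mul1r.
Qed.

Hypothesis P_closed : forall a, closed (P a : set {ptws Omega -> R}).

(** [get] returns the maximum once one exists. The best decomposition of length [#|Omega|] provides
    it, and the single belief [mu] with label [a] shows that there is such a decomposition. *)
Lemma persuasion_value_max mu a : P a mu ->
  payoffs rho v mu (persuasion_value rho v mu) /\
  ubound (payoffs rho v mu) (persuasion_value rho v mu).
Proof.
move=> Pmu; have mu_simplex : simplex mu by case: Pmu.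
have P_simplex a' : P a' `<=` simplex by move=> ? [].
have P_sum1 a' x : P a' x -> \sum_w x w = 1 by move=> /P_simplex[].
apply: (getPex (P := payoffs rho v mu `&` ubound (payoffs rho v mu))).
have dec1 : decomposes P u 1 mu (u a mu).
  by have := decomposes1 u ler01 Pmu; rewrite scale1r mul1r.
have [y0 _ dec0] := decomposes_card P_sum1 Pmu dec1.
have [y decy ymax] := decomposes_max P_simplex P_closed
  (fun a' => @expect_continuous (v^~ a')) mu_simplex dec0.
exists y; split; first exact: decomposes_payoffs decy.
move=> _ [t tF <-]; rewrite payoffE.
have [n] := feasible_decomposes tF.
move=> /(decomposes_card P_sum1 Pmu)[y' le_y' /ymax]; exact: le_trans.
Qed.

(** * The criterion in terms of beliefs *)

(** The line through [m] and [mu] stays in the hyperplane, so by continuity its points close enough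
    to [mu] lie in [B], including those beyond [mu]. *)
Lemma interior_extrapolation B mu m :
  \sum_w mu w = 1 -> \sum_w m w = 1 -> hyperplane_interior B mu ->
  exists2 s : R, 0 < s & B (mu + s *: (mu - m)).
Proof.
move=> mu1 m1 intB.
have nB : within hyperplane (nbhs (mu : {ptws Omega -> R})) B.
  by rewrite nbhs_subspace_in.
pose g : R -> {ptws Omega -> R} := fun s => mu + s *: (mu - m).
have g_cont : continuous g.
  apply: ptws_continuous => w s; apply: cvgD; first exact: cvg_cst.
  by apply: cvgM; [exact: cvg_id|exact: cvg_cst].
have g0 : g 0 = mu by rewrite /g scale0r addr0.
have nBg : \forall s \near 0^'+, hyperplane (g s) -> B (g s).
  apply: (@cvg_within _ (nbhs (0 : R)) _).
  by have /(_ (fun x => hyperplane x -> B x)) := @g_cont 0; rewrite g0; apply.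
have [s [s0 Bs]] : exists s : R, 0 < s /\ (hyperplane (g s) -> B (g s)).
  apply: (@filter_ex _ (0 : R)^'+).
  by apply: filterI => //; exact: nbhs_right_gt.
exists s => //; apply: Bs; rewrite /hyperplane /g /=.
rewrite big_split /= mu1 -mulr_sumr sumrB mu1 m1 subrr mulr0 addr0 //.
Qed.

Variable act : (Omega -> R) -> A.
Hypothesis act_pref : sender_preferred rho v act.

Lemma not_benefits mustar : simplex mustar ->
  (forall mu, simplex mu -> nu_hat v act mu <= expect mu (v^~ (act mustar))) ->
  ~ benefits rho v act mustar.
Proof.
move=> s_mustar no_info.
have [Pstar _] := act_pref s_mustar.
have [[t [tC t_sum] tE] _] := persuasion_value_max Pstar.
rewrite /benefits -tE payoffE => /lt_geF/negP; apply.
(* The payoff without persuasion is split along the sum of the [t a], so that the two payoffs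
   compare action by action. *)
rewrite /nu_hat; set f := v^~ (act mustar); rewrite -[in leRHS]t_sum.
rewrite -[in leRHS](eq_bigr _ (fun a _ => scale1r (t a))) expect_sum.
apply: ler_sum => a _; rewrite mul1r -subr_le0 -expectB.
pose g w := v w a - f w.
suff : [set x | expect x g <= 0] (t a) by [].
apply: Conv_sub (tC a); first exact: convex_halfspace.
move=> x [[sx rx]|->]; last by rewrite /= expect0.
rewrite /= /expect expectB subr_le0; apply: le_trans (no_info _ sx).
(* At a belief where [a] is optimal, the sender-preferred action is worth at least [a]. *)
by have [_] := act_pref sx; exact.
Qed.

Lemma benefits_of_info mustar mu : simplex mustar -> simplex mu ->
  expect mu (v^~ (act mustar)) < nu_hat v act mu ->
  hyperplane_interior (P (act mustar)) mustar ->
  benefits rho v act mustar.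
Proof.
move=> s_mustar s_mu info intP.
have [Pstar _] := act_pref s_mustar; have [Pmu _] := act_pref s_mu.
have [_ Vub] := persuasion_value_max Pstar.
have [s s0 Pp] := interior_extrapolation s_mustar.2 s_mu.2 intP.
set p := _ + _ in Pp.
have s1 : 0 < 1 + s by rewrite addr_gt0.
have s10 : 1 + s != 0 by rewrite gt_eqF.
have mustarE : mustar = (1 + s)^-1 *: p + (s / (1 + s)) *: mu.
  apply/funext => w; rewrite [RHS](_ : _ = (1 + s)^-1 *
    (mustar w + s * (mustar w - mu w)) + s / (1 + s) * mu w) //.
  by field.
have k0 : 0 <= (1 + s)^-1 by rewrite invr_ge0 ltW.
have k'0 : 0 < s / (1 + s) by rewrite divr_gt0.
(* The posterior [p] keeps the label [act mustar], so its contribution matches the status quo and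
   the strict gain comes from [mu] alone. *)
have := decomposesD (decomposes1 u k0 Pp) (decomposes1 u (ltW k'0) Pmu).
rewrite -mustarE => /(decomposes_payoffs s_mustar) /Vub; apply: lt_le_trans.
rewrite /nu_hat; set f := v^~ (act mustar); rewrite [in ltLHS]mustarE.
rewrite expectD !expectZ.
by rewrite ltrD2l ltr_pM2l.
Qed.

End Persuasion.

(** * From beliefs to convex hulls of optimality regions *)

Theorem proposition2 (R : realType) (Omega A : finType)
    (hOmega : (0 < #|Omega|)%N) (hA : (0 < #|A|)%N)
    (rho : (Omega -> R) -> A -> R) (v : Omega -> A -> R)
    (act : (Omega -> R) -> A) (hact : sender_preferred rho v act)
    (mustar : Omega -> R) (hmustar : simplex mustar)
    (hclosed : forall a : A,
      closed (optimal_beliefs rho a : set {ptws Omega -> R})) :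
  (((forall mu : Omega -> R, simplex mu ->
        nu_hat v act mu <= expect mu (fun w => v w (act mustar))) ->
      ~ benefits rho v act mustar) /\
   ((exists mu : Omega -> R, simplex mu /\
        expect mu (fun w => v w (act mustar)) < nu_hat v act mu) ->
      hyperplane_interior (optimal_beliefs rho (act mustar)) mustar ->
      benefits rho v act mustar)) /\
  (((forall (a : A) (m : Omega -> R), Conv (optimal_beliefs rho a) m ->
        \sum_w m w * (v w a - v w (act mustar)) <= 0) ->
      ~ benefits rho v act mustar) /\
   (hyperplane_interior (optimal_beliefs rho (act mustar)) mustar ->
      (exists (a : A) (m : Omega -> R), Conv (optimal_beliefs rho a) m /\
        0 < \sum_w m w * (v w a - v w (act mustar))) ->
      benefits rho v act mustar)).
Proof.
(* A linear functional that is positive somewhere on a convex hull is positive at some generator;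
   there the sender-preferred action gains at least as much as [a]. *)
have info_of_Conv a m : Conv (optimal_beliefs rho a) m ->
    0 < \sum_w m w * (v w a - v w (act mustar)) ->
    exists mu, simplex mu /\ expect mu (v^~ (act mustar)) < nu_hat v act mu.
  move=> Cm gain; apply: contrapT => no_info.
  move: gain; apply/negP; rewrite -leNgt.
  pose g w := v w a - v w (act mustar).
  suff : [set x | expect x g <= 0] m by [].
  apply: Conv_sub Cm; first exact: convex_halfspace.
  move=> mu [s_mu rho_mu]; rewrite /= /expect expectB subr_le0.
  rewrite leNgt; apply/negP => gain; apply: no_info; exists mu; split=> //.
  by apply: lt_le_trans gain _; have [_] := hact _ s_mu; exact.
split; split.
- exact: not_benefits.
- by move=> [mu [s_mu info]]; exact: benefits_of_info info.
(* The assumption is used at the action [act mu] and the point [mu] itself. *)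
- move=> no_gain; apply: not_benefits => // mu s_mu.
  have [Pmu _] := hact _ s_mu.
  by rewrite -subr_le0 -expectB; apply: no_gain; exact: sub_Conv.
- move=> intP [a [m [Cm gain]]].
  have [mu [s_mu info]] := info_of_Conv _ _ Cm gain.
  exact: benefits_of_info info intP.
Qed.
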